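(* Let $(X,\sigma)$ be a Toeplitz subshift with period structure $(p_n)$. Then the stabilized automorphism group $\operatorname{Aut}^{(\infty)}(X,\sigma)$ is isomorphic to the direct limit of a sequence of group monomorphisms $G_0\to G_1\to G_2\to\cdots$ in which each group $G_j$ is of the form $\operatorname{Aut}(T,\tau)^{p_k}\rtimes\operatorname{Sym}(p_k)$, where $(T,\tau)$ is a Toeplitz subshift and $p_k$ is a term of the sequence $(p_n)$.
   Context: Let $\mathcal{A}$ be a finite alphabet and $\sigma$ the left shift on $\mathcal{A}^{\mathbb{Z}}$, $(\sigma x)_i=x_{i+1}$. A sequence $u\in\mathcal{A}^{\mathbb{Z}}$ is a Toeplitz sequence if for every $n\in\mathbb{Z}$ there is $m\ge1$ with $u_n=u_{n+km}$ for all $k\in\mathbb{Z}$; it is assumed non-periodic. For $p\ge1$ let $\operatorname{per}_p(u)=\{k : u_k=u_{k+pm}\ \forall m\in\mathbb{Z}\}$. A period structure of $u$ is a sequence $(p_n)$ with $p_n\mid p_{n+1}$, $\bigcup_n\operatorname{per}_{p_n}(u)=\mathbb{Z}$, and each $p_n$ essential (for $1\le p<p_n$, $\operatorname{per}_p(u)\ne\operatorname{per}_{p_n}(u)$). The Toeplitz subshift given by $u$ is $(X,\sigma)$ with $X$ the closure of the $\sigma$-orbit of $u$. For a homeomorphism $T$ of a compact metric space $X$, $\operatorname{Aut}(X,T)$ is the group of homeomorphisms commuting with $T$ and $\operatorname{Aut}^{(\infty)}(X,T)=\bigcup_{n\ge1}\operatorname{Aut}(X,T^n)\subseteq\operatorname{Homeo}(X)$.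 $\operatorname{Sym}(n)$ is the symmetric group, acting on $H^n$ by permuting coordinates in $H^n\rtimes\operatorname{Sym}(n)$. *)

(* Defs.v *)
From Stdlib Require Import ZArith Lia.
From mathcomp Require Import all_boot all_fingroup.

Set Implicit Arguments.
Unset Strict Implicit.
Unset Printing Implicit Defensive.

Record grp := Grp { gcar :> Type; gmul : gcar -> gcar -> gcar }.

Definition ghom (G H : grp) (f : G -> H) : Prop :=
  forall a b : G, f (gmul a b) = gmul (f a) (f b).

Definition gmono (G H : grp) (f : G -> H) : Prop :=
  ghom f /\ (forall a b : G, f a = f b -> a = b).

(* H is (isomorphic to) the direct limit of the sequence of group
   monomorphisms phi j : G j -> G (j+1): there is a compatible family of
   embeddings psi j : G j -> H whose images exhaust H.  (For a system of
   monomorphisms this is exactly the universal description of the colimit.) *)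
Definition is_direct_limit (G : nat -> grp) (phi : forall j, G j -> G j.+1)
  (H : grp) : Prop :=
  exists psi : forall j, G j -> H,
    (forall j, gmono (psi j)) /\
    (forall j (g : G j), psi j.+1 (phi j g) = psi j g) /\
    (forall h : H, exists j (g : G j), psi j g = h).

Definition shift (B : Type) (x : Z -> B) : Z -> B := fun i => x (i + 1)%Z.

Definition agree (B : Type) (n : nat) (x y : Z -> B) : Prop :=
  forall i : Z, (- Z.of_nat n <= i <= Z.of_nat n)%Z -> x i = y i.

Section Subspace.
Variables (B : Type) (P : (Z -> B) -> Prop).

Definition pt := {x : Z -> B | P x}.

(* continuity for the (restricted) product topology on B^Z *)
Definition contf (f : pt -> pt) : Prop :=
  forall (x : pt) (n : nat), exists m : nat, forall y : pt,
    agree m (proj1_sig x) (proj1_sig y) ->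
    agree n (proj1_sig (f x)) (proj1_sig (f y)).

Definition homeo (f : pt -> pt) : Prop :=
  contf f /\ exists g : pt -> pt,
    [/\ contf g, (forall x, g (f x) = x) & (forall x, f (g x) = x)].

Lemma contf_comp f g : contf f -> contf g -> contf (fun x => f (g x)).
Proof.
move=> cf cg x n; have [m Hm] := cf (g x) n; have [k Hk] := cg x m.
by exists k => y /Hk /Hm.
Qed.

Lemma homeo_comp f g : homeo f -> homeo g -> homeo (fun x => f (g x)).
Proof.
move=> [cf [f' [cf' f1 f2]]] [cg [g' [cg' g1 g2]]]; split; first exact: contf_comp.
exists (fun x => g' (f' x)); split; first exact: contf_comp.
- by move=> x; rewrite f1 g1.
- by move=> x; rewrite g2 f2.
Qed.

End Subspace.

Section Toeplitz.
Variables (A : finType) (u : Z -> A).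

Definition per (p : nat) (k : Z) : Prop :=
  forall m : Z, u k = u (k + Z.of_nat p * m)%Z.

Definition periodic : Prop :=
  exists p : Z, (1 <= p)%Z /\ forall n : Z, u (n + p)%Z = u n.

Definition toeplitz : Prop :=
  (forall n : Z, exists m : Z, (1 <= m)%Z /\ forall k : Z, u n = u (n + k * m)%Z)
  /\ ~ periodic.

Definition essential (p : nat) : Prop :=
  forall q : nat, 1 <= q < p -> ~ (forall k : Z, per q k <-> per p k).

Definition period_structure (p : nat -> nat) : Prop :=
  [/\ (forall n, 0 < p n),
      (forall n, p n %| p n.+1),
      (forall k : Z, exists n, per (p n) k)
    & (forall n, essential (p n))].

Definition in_orbit_closure (x : Z -> A) : Prop :=
  forall n : nat, exists k : Z, agree n x (fun i => u (i + k)%Z).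

Definition Xpt := pt in_orbit_closure.

Lemma shift_closed (x : Z -> A) :
  in_orbit_closure x -> in_orbit_closure (shift x).
Proof.
move=> H n; have [k Hk] := H n.+1; exists (k + 1)%Z => i Hi.
rewrite /shift Hk; first by f_equal; lia.
rewrite Nat2Z.inj_succ; lia.
Qed.

Definition sigmaX (x : Xpt) : Xpt :=
  exist _ (shift (proj1_sig x)) (shift_closed (proj2_sig x)).

Definition is_aut (f : Xpt -> Xpt) : Prop :=
  homeo f /\ forall x, f (sigmaX x) = sigmaX (f x).

Definition Aut := {f : Xpt -> Xpt | is_aut f}.

Lemma is_aut_comp (f g : Xpt -> Xpt) :
  is_aut f -> is_aut g -> is_aut (fun x => f (g x)).
Proof.
move=> [hf cf] [hg cg]; split; first exact: homeo_comp.
by move=> x; rewrite cg cf.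
Qed.

Definition aut_mul (f g : Aut) : Aut :=
  exist _ _ (is_aut_comp (proj2_sig f) (proj2_sig g)).

Definition is_autinf (f : Xpt -> Xpt) : Prop :=
  homeo f /\ exists n : nat, 0 < n /\
    forall x, f (iter n sigmaX x) = iter n sigmaX (f x).

Definition AutInf := {f : Xpt -> Xpt | is_autinf f}.

Lemma commute_iter (f s : Xpt -> Xpt) k :
  (forall x, f (s x) = s (f x)) -> forall x, f (iter k s x) = iter k s (f x).
Proof. by move=> H; elim: k => // k IH x; rewrite !iterS H IH. Qed.

Lemma iter_mul (s : Xpt -> Xpt) k n x : iter (k * n) s x = iter k (iter n s) x.
Proof. by elim: k => // k IH; rewrite mulSn iterD IH. Qed.

Lemma is_autinf_comp (f g : Xpt -> Xpt) :
  is_autinf f -> is_autinf g -> is_autinf (fun x => f (g x)).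
Proof.
move=> [hf [n [n0 cf]]] [hg [m [m0 cg]]]; split; first exact: homeo_comp.
exists (m * n); split; first by rewrite muln_gt0 m0 n0.
have Cg : forall y, g (iter (m * n) sigmaX y) = iter (m * n) sigmaX (g y).
  by move=> y; rewrite mulnC !iter_mul (commute_iter n (s := iter m sigmaX) cg).
have Cf : forall y, f (iter (m * n) sigmaX y) = iter (m * n) sigmaX (f y).
  by move=> y; rewrite !iter_mul (commute_iter m (s := iter n sigmaX) cf).
by move=> x; rewrite Cg Cf.
Qed.

Definition autinf_mul (f g : AutInf) : AutInf :=
  exist _ _ (is_autinf_comp (proj2_sig f) (proj2_sig g)).

Definition AutInf_grp : grp := Grp autinf_mul.

(* Aut(X, sigma)^p  x|  Sym(p), Sym(p) acting by permuting coordinates: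
   (pi . g)_i = g_(pi i) (a left action for mathcomp's product on {perm _},
   (pi * rho) i = rho (pi i)). *)
Definition SD_mul (p : nat) (a b : ('I_p -> Aut) * {perm 'I_p}) :
  ('I_p -> Aut) * {perm 'I_p} :=
  (fun i => aut_mul (a.1 i) (b.1 (a.2 i)), (a.2 * b.2)%g).

Definition SD_grp (p : nat) : grp := Grp (@SD_mul p).

End Toeplitz.

(* Main.v *)
(** For q = p k and any multiple m of q with gcd (m, p l) = q for all l >= k, the
    homeomorphism sigma^m of X has exactly q minimal components: essentiality of
    q makes the phase modulo q of a point locally constant, and Bezout against
    some p l makes the sigma^m-orbit of u as dense as its sigma^q-orbit.  Each
    component is conjugate to the subshift of the m-block recoding v of u, which
    is again Toeplitz, so X is q copies of T = X(v), and a homeomorphism commuting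
    with sigma^m permutes the copies and acts on each by an element of Aut(T).
    Taking m_j = lcm (j!, p (k_j)), with k_j so large that gcd (j!, p l) is
    constant for l >= k_j, the condition holds with q = p (k_j), the m_j form a
    divisibility chain, and every n >= 1 divides some m_j.  Hence Aut^(oo)(X) is
    the increasing union of the groups Aut(X, sigma^(m_j)). *)

Require Import Defs.
From Stdlib Require Import ZArith Lia Classical ClassicalEpsilon.
From Stdlib Require Import ProofIrrelevance FunctionalExtensionality.
From mathcomp Require Import all_boot all_fingroup zify_ssreflect.
From mathcomp Require order.

Set Implicit Arguments.
Unset Strict Implicit.
Unset Printing Implicit Defensive.

(* Otherwise /= turns [Z.of_nat M.+1 * z] into a match that lia cannot read. *)
#[local] Arguments Z.of_nat : simpl never.
#[local] Arguments Z.mul : simpl never.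

(** * Periodic positions and the arithmetic of the period structure *)

Section Sequences.
Variables (A : finType) (u : Z -> A).

Lemma per_dvd q r k : q %| r -> per u q k -> per u r k.
Proof.
move=> /dvdnP [c ->] Hq z.
by rewrite (Hq (Z.of_nat c * z)%Z); congr (u _); lia.
Qed.

Lemma per_shift q k z : per u q k -> per u q (k + Z.of_nat q * z).
Proof.
move=> Hq t; rewrite -Hq (Hq (z + t)%Z); congr (u _); lia.
Qed.

(** By Bezout, translation by [g = gcd (d, q)] combines translations by [d] and by [q], so every
    [q]-periodic position is already [g]-periodic; essentiality then forces [g = q]. *)
Lemma essential_invariance q (d : Z) : 0 < q -> essential u q ->
  (forall k, per u q k -> per u q (k + d) /\ u (k + d)%Z = u k) ->
  (Z.of_nat q | d)%Z.
Proof.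
move=> q0 Eq Hd.
have Hdn k (n : nat) : per u q k ->
    per u q (k + d * Z.of_nat n) /\ u (k + d * Z.of_nat n)%Z = u k.
  move=> Hk; elim: n => [|n [IH1 IH2]].
    by have -> : (k + d * Z.of_nat 0 = k)%Z by lia.
  have -> : (k + d * Z.of_nat n.+1 = k + d * Z.of_nat n + d)%Z by lia.
  by have [H1 H2] := Hd _ IH1; rewrite H2 IH2.
have g0 := Z.gcd_nonneg d (Z.of_nat q).
have [[c Hc] [e He]] := (Z.gcd_divide_l d (Z.of_nat q), Z.gcd_divide_r d (Z.of_nat q)).
have [x [y Hxy]] := Z.gcd_bezout d (Z.of_nat q) _ erefl.
set g := Z.gcd d (Z.of_nat q) in g0 c Hc e He Hxy *.
have gE : Z.of_nat (Z.to_nat g) = g by lia.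
have [ltgq|leqg] := ltnP (Z.to_nat g) q; last first.
  exists c; have : e = 1%Z by nia.
  by nia.
have gpos : 1 <= Z.to_nat g by nia.
exfalso; apply: (Eq (Z.to_nat g)); first by rewrite gpos ltgq.
move=> k; split.
  by apply: per_dvd; apply/dvdnP; exists (Z.to_nat e); nia.
move=> Hk w; rewrite gE.
(* [Hdn] only iterates [d] forwards, so the coefficient of [d] is reduced to a residue [t >= 0]
   modulo [q]; the rest is a multiple of [q]. *)
have Zq : (Z.of_nat q <> 0)%Z by lia.
have xd := Z.div_mod (w * x) (Z.of_nat q) Zq.
have [xm _] := Z.mod_pos_bound (w * x) (Z.of_nat q) ltac:(lia).
set t := Z.modulo (w * x) (Z.of_nat q) in xd xm.
set s := Z.div (w * x) (Z.of_nat q) in xd.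
have [H1 H2] := Hdn k (Z.to_nat t) Hk.
rewrite -H2 (H1 (d * s + w * y)%Z); congr (u _); rewrite Z2Nat.id //.
have -> : (g * w = (w * x) * d + (w * y) * Z.of_nat q)%Z by rewrite -Hxy; ring.
by rewrite xd; ring.
Qed.

Variable p : nat -> nat.
Hypothesis Hp : period_structure u p.

Lemma structure_dvd i j : i <= j -> p i %| p j.
Proof.
case: Hp => _ Hd _ _ /subnKC <-; elim: (j - i) => [|n IH]; first by rewrite addn0.
by rewrite addnS; apply: dvdn_trans IH _.
Qed.

Lemma per_window k n c : exists l, k <= l /\
  forall i : Z, (- Z.of_nat n <= i <= Z.of_nat n)%Z -> per u (p l) (i + c).
Proof.
have [_ _ Hc _] := Hp.
elim: n => [|n [l [kl IH]]].
  have [l Hl] := Hc c; exists (maxn k l); split; first exact: leq_maxl.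
  move=> i Hi; have -> : (i + c = c)%Z by lia.
  exact: per_dvd (structure_dvd (leq_maxr k l)) Hl.
have [a Ha] := Hc (Z.of_nat n.+1 + c)%Z; have [b Hb] := Hc (- Z.of_nat n.+1 + c)%Z.
exists (maxn l (maxn a b)); split; first by lia.
move=> i Hi.
have [->|[->|Hi']] : i = Z.of_nat n.+1 \/ i = (- Z.of_nat n.+1)%Z \/
    (- Z.of_nat n <= i <= Z.of_nat n)%Z by lia.
- by apply: per_dvd Ha; apply: structure_dvd; lia.
- by apply: per_dvd Hb; apply: structure_dvd; lia.
- by apply: per_dvd (IH _ Hi'); apply: structure_dvd; lia.
Qed.

(** Both positions that witness a failure of [p k]-periodicity are made [p l]-periodic, so that each
    can be moved by multiples of [p l] into any window of that length. *)
Lemma aperiodic_witness k n : exists l, k <= l /\ forall r : nat, r < n ->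
  ~ per u (p k) (Z.of_nat r) -> exists z : Z,
    [/\ u (Z.of_nat r) <> u (Z.of_nat r + Z.of_nat (p k) * z)%Z,
        per u (p l) (Z.of_nat r)
      & per u (p l) (Z.of_nat r + Z.of_nat (p k) * z)].
Proof.
have [_ _ Hc _] := Hp.
elim: n => [|n [l [kl IH]]]; first by exists k.
have [Hn|Hn] := classic (per u (p k) (Z.of_nat n)).
  exists l; split=> // r; rewrite ltnS leq_eqVlt => /orP [/eqP -> //|]; exact: IH.
have [z Hz] := not_all_ex_not _ _ Hn.
have [a Ha] := Hc (Z.of_nat n); have [b Hb] := Hc (Z.of_nat n + Z.of_nat (p k) * z)%Z.
exists (maxn l (maxn a b)); split; first by lia.
move=> r; rewrite ltnS leq_eqVlt => /orP [/eqP -> _|rn Hr].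
  by exists z; split=> //; [apply: per_dvd Ha|apply: per_dvd Hb];
    apply: structure_dvd; lia.
have [y [y1 y2 y3]] := IH _ rn Hr.
by exists y; split=> //; [apply: per_dvd y2|apply: per_dvd y3];
  apply: structure_dvd; lia.
Qed.

Lemma translate_to_window (L : nat) (e c : Z) : 0 < L -> exists s : Z,
  (- Z.of_nat L <= e + Z.of_nat L * s - c <= Z.of_nat L)%Z.
Proof.
move=> L0; exists (- ((e - c) / Z.of_nat L))%Z.
have := Z.div_mod (e - c) (Z.of_nat L) ltac:(lia).
have := Z.mod_pos_bound (e - c) (Z.of_nat L) ltac:(lia).
lia.
Qed.

(* Occurrences of a long enough window of u determine the position modulo p k:
   the p k-periodic positions of one occurrence must also be p k-periodic in the
   other, because non-periodicity is already visible in every long window. *)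
Lemma phase_recognition k : exists N, forall a b : Z,
  agree N (fun i => u (i + a)%Z) (fun i => u (i + b)%Z) ->
  (Z.of_nat (p k) | b - a)%Z.
Proof.
have [Hpos _ _ Hess] := Hp.
have [l [kl Hl]] := aperiodic_witness k (p k).
exists (p l) => a b Hab.
apply: essential_invariance => // c Hc.
have q0 := Hpos k; have L0 := Hpos l.
have /dvdnP [w Hw] := structure_dvd kl.
(* Slide [e] into the window around [b]; the agreement carries it to the window around [a], at a
   position congruent to [c] modulo [p k]. *)
have Hval e : per u (p l) e -> (exists z, e = c + (b - a) + Z.of_nat (p k) * z)%Z ->
    u e = u c.
  move=> He [z Hz].
  have [s Hs] := translate_to_window e b L0.
  rewrite (He s).
  have -> : (e + Z.of_nat (p l) * s = e + Z.of_nat (p l) * s - b + b)%Z by lia.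
  rewrite -(Hab _ Hs) /=.
  rewrite [RHS](Hc (z + Z.of_nat w * s)%Z); congr (u _); rewrite Hz Hw; lia.
(* Otherwise two positions in this class would have different values, while [Hval] gives both the
   value [u c]. *)
have Hper : per u (p k) (c + (b - a)).
  apply: NNPP => Hn.
  have cd := Z.div_mod (c + (b - a)) (Z.of_nat (p k)) ltac:(lia).
  have cm := Z.mod_pos_bound (c + (b - a)) (Z.of_nat (p k)) ltac:(lia).
  set r := Z.modulo _ _ in cd cm; set t := Z.div _ _ in cd.
  have rE : Z.of_nat (Z.to_nat r) = r by lia.
  have [||z []] := Hl (Z.to_nat r); first by lia.
    rewrite rE => Hr; apply: Hn; rewrite cd Z.add_comm; exact: per_shift.
  rewrite rE => Hne P1 P2; apply: Hne.
  rewrite !Hval //; first by exists (z - t)%Z; lia.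
  by exists (- t)%Z; lia.
split=> //.
have [s Hs] := translate_to_window (c + (b - a)) b L0.
rewrite (Hper (Z.of_nat w * s)%Z).
have E : (c + (b - a) + Z.of_nat (p k) * (Z.of_nat w * s)
   = c + (b - a) + Z.of_nat (p l) * s - b + b)%Z by rewrite Hw; lia.
rewrite E -(Hab _ Hs) /= [RHS](Hc (Z.of_nat w * s)%Z); congr (u _); lia.
Qed.

Lemma progression_density k m : 0 < m ->
  (forall l, k <= l -> gcdn m (p l) = p k) ->
  forall (a : Z) n, exists b : Z,
  agree n (fun i => u (i + Z.of_nat (p k) * a)%Z) (fun i => u (i + Z.of_nat m * b)%Z).
Proof.
move=> m0 Hm a n.
have [l [kl Hl]] := per_window k n (Z.of_nat (p k) * a).
(* Since [x * m = y * p l + p k], the shifts by [p k * a] and by [m * x * a] differ by a multiple of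
   [p l], invisible in the window. *)
have := Hm _ kl; case: (egcdnP (p l) m0) => x y Hxy _ E.
rewrite E in Hxy.
exists (Z.of_nat x * a)%Z => i Hi.
rewrite (Hl i Hi (Z.of_nat y * a)%Z); congr (u _).
have : (Z.of_nat x * Z.of_nat m = Z.of_nat y * Z.of_nat (p l) + Z.of_nat (p k))%Z by lia.
nia.
Qed.

Lemma stable_gcd n : 0 < n ->
  exists k, forall l, k <= l -> gcdn n (p l) = gcdn n (p k).
Proof.
move=> n0; apply: NNPP => H.
have [Hpos _ _ _] := Hp.
(* The gcds grow along the divisibility chain, so without stabilization they would exceed [n]. *)
suff Hb b : exists k, b <= gcdn n (p k).
  have [k Hk] := Hb n.+1.
  by have := dvdn_leq n0 (dvdn_gcdl n (p k)); lia.
elim: b => [|b [k Hk]]; first by exists 0.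
have [l Hkl] := not_all_ex_not _ _ (not_ex_all_not _ _ H k).
have [kl Hl] := imply_to_and _ _ Hkl.
exists l; apply: leq_ltn_trans Hk _.
rewrite ltn_neqAle; apply/andP; split; first by apply/eqP => E; apply: Hl.
apply: dvdn_leq; first by rewrite gcdn_gt0 n0.
by rewrite dvdn_gcd dvdn_gcdl (dvdn_trans (dvdn_gcdr _ _) (structure_dvd kl)).
Qed.

Lemma gcd_lcm_stable n k : (forall l, k <= l -> gcdn n (p l) = gcdn n (p k)) ->
  forall l, k <= l -> gcdn (lcmn n (p k)) (p l) = p k.
Proof.
move=> H l kl.
(* Distributivity of gcd over lcm. *)
rewrite order.Order.NatDvd.meetUl H // (gcdn_idPl (structure_dvd kl)) lcmnC.
exact/lcmn_idPl/dvdn_gcdr.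
Qed.

End Sequences.

(** * Direct limits from nested images, and points of subshifts *)

Lemma direct_limit_of_tower (G : nat -> grp) (H : grp) (psi : forall j, G j -> H) :
  (forall j, gmono (psi j)) ->
  (forall j g, exists g', psi j.+1 g' = psi j g) ->
  (forall h, exists j g, psi j g = h) ->
  exists phi : forall j, G j -> G j.+1,
    (forall j, gmono (phi j)) /\ is_direct_limit phi H.
Proof.
move=> Hm Hi He.
pose phi j (g : G j) := sval (constructive_indefinite_description _ (Hi j g)).
have phiE j g : psi j.+1 (phi j g) = psi j g.
  by rewrite /phi; case: constructive_indefinite_description.
exists phi; split; last by exists psi.
move=> j; have [Hh Hinj] := Hm j; have [Hh' Hinj'] := Hm j.+1.
split=> [a b|a b E]; first by apply: Hinj'; rewrite Hh' !phiE Hh.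
by apply: Hinj; rewrite -phiE E phiE.
Qed.

(* For P = Q this is convertible to [contf]. *)
Definition contpt (B C : Type) (P : (Z -> B) -> Prop) (Q : (Z -> C) -> Prop)
    (f : pt P -> pt Q) : Prop :=
  forall (x : pt P) (n : nat), exists m : nat, forall y : pt P,
    agree m (proj1_sig x) (proj1_sig y) ->
    agree n (proj1_sig (f x)) (proj1_sig (f y)).

Lemma contpt_comp (B C D : Type) (P : (Z -> B) -> Prop) (Q : (Z -> C) -> Prop)
    (S : (Z -> D) -> Prop) (f : pt Q -> pt S) (g : pt P -> pt Q) :
  contpt f -> contpt g -> contpt (fun x => f (g x)).
Proof.
move=> cf cg x n; have [m Hm] := cf (g x) n; have [k Hk] := cg x m.
by exists k => y /Hk /Hm.
Qed.

Lemma agree_le (B : Type) n n' (x y : Z -> B) : n <= n' -> agree n' x y -> agree n x y.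
Proof. move=> le H i Hi; apply: H; lia. Qed.

Lemma agree_sym (B : Type) n (x y : Z -> B) : agree n x y -> agree n y x.
Proof. by move=> H i Hi; rewrite H. Qed.

Lemma agree_trans (B : Type) n (x y z : Z -> B) :
  agree n x y -> agree n y z -> agree n x z.
Proof. by move=> H K i Hi; rewrite H // K. Qed.

Lemma pt_inj (B : Type) (P : (Z -> B) -> Prop) (x y : pt P) :
  (forall i, proj1_sig x i = proj1_sig y i) -> x = y.
Proof.
case: x y => [x Hx] [y Hy] /= E; have {}E := functional_extensionality _ _ E.
by subst y; congr exist; apply: proof_irrelevance.
Qed.

Lemma iter_sigmaX (A : finType) (u : Z -> A) n (x : Xpt u) i :
  proj1_sig (iter n (@sigmaX A u) x) i = proj1_sig x (i + Z.of_nat n)%Z.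
Proof.
elim: n x i => [|n IH] x i; first by congr (proj1_sig x _); lia.
by rewrite iterSr IH /= /shift; congr (proj1_sig x _); lia.
Qed.

(** * Recoding by blocks of length m *)

Section Blocks.
Variables (A : finType) (u : Z -> A) (M q : nat).
Local Notation m := M.+1.
Local Notation zm := (Z.of_nat M.+1).

(* [blk i] reads m-blocks starting at position [- i], so that it recodes the
   i-th component of X; [flat i] is its inverse. *)
Definition blk (i : nat) (x : Z -> A) : Z -> {ffun 'I_m -> A} :=
  fun n => [ffun r : 'I_m => x (zm * n + Z.of_nat r - Z.of_nat i)%Z].

Definition flat (i : nat) (y : Z -> {ffun 'I_m -> A}) : Z -> A :=
  fun z => y ((z + Z.of_nat i) / zm)%Z
             (inord (Z.to_nat ((z + Z.of_nat i) mod zm))).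

Lemma div_mod_block z i :
  ((z + Z.of_nat i) = zm * ((z + Z.of_nat i) / zm) + ((z + Z.of_nat i) mod zm) /\
   0 <= (z + Z.of_nat i) mod zm < zm)%Z.
Proof. split; [apply: Z.div_mod; lia | apply: Z.mod_pos_bound; lia]. Qed.

Lemma blkK i x z : flat i (blk i x) z = x z.
Proof.
rewrite /flat /blk ffunE inordK.
  by have [H1 H2] := div_mod_block z i; congr (x _); lia.
have [_ H] := div_mod_block z i; lia.
Qed.

Lemma flatK i y n : blk i (flat i y) n = y n.
Proof.
apply/ffunP => r; rewrite ffunE /flat.
have lt_r := ltn_ord r.
have -> : (zm * n + Z.of_nat r - Z.of_nat i + Z.of_nat i = Z.of_nat r + n * zm)%Z by lia.
rewrite Z.div_add; last by lia.
rewrite Z.mod_add; last by lia.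
rewrite Z.div_small; last by lia.
rewrite Z.mod_small; last by lia.
by congr (y _ _); apply: val_inj; rewrite /= inordK Nat2Z.id.
Qed.

Lemma agree_flat i n y y' : agree (n + i) y y' -> agree n (flat i y) (flat i y').
Proof.
move=> H z Hz; rewrite /flat H //.
split; [apply: Z.div_le_lower_bound | apply: Z.div_le_upper_bound]; nia.
Qed.

Lemma agree_blk i n x x' :
  agree (m * n.+1 + i) x x' -> agree n (blk i x) (blk i x').
Proof.
move=> H z Hz; apply/ffunP => r; rewrite !ffunE H //.
have := ltn_ord r; nia.
Qed.

Let v := blk 0 u.

(** Offset [i] turns the orbit of the single sequence [v] into the translates of [u] by [m Z + i],
    so one [v] serves all components. *)
Lemma flat_block_shift i a z :
  flat i (fun n => v (n + a)%Z) z = u (z + (zm * a + Z.of_nat i))%Z.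
Proof.
rewrite /flat /v /blk ffunE inordK; have [H1 H2] := div_mod_block z i; last by lia.
congr (u _); lia.
Qed.

Lemma blk_shift i a n :
  blk i (fun z => u (z + (zm * a + Z.of_nat i))%Z) n = v (n + a)%Z.
Proof. by apply/ffunP => r; rewrite !ffunE; congr (u _); lia. Qed.

Lemma block_toeplitz p : toeplitz u -> period_structure u p -> toeplitz v.
Proof.
move=> [_ Hap] Hp; split.
  (* A window of radius [m] covers the whole block [n]; a common period [p l] of its letters is also
     a period in block units. *)
  move=> n; have [l [_ Hl]] := per_window Hp 0 m (zm * n).
  have [Hpos _ _ _] := Hp; exists (Z.of_nat (p l)); split; first by have := Hpos l; lia.
  move=> k; apply/ffunP => r; rewrite !ffunE.
  have lt_r := ltn_ord r.
  have := Hl (Z.of_nat r) ltac:(lia) (zm * k)%Z.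
  have -> : (Z.of_nat r + zm * n = zm * n + Z.of_nat r - Z.of_nat 0)%Z by lia.
  by move=> ->; congr (u _); lia.
move=> [t [t1 Ht]]; apply: Hap; exists (zm * t)%Z; split; first by nia.
move=> n; rewrite -(blkK 0 u n) -(blkK 0 u (n + zm * t)) -/v /flat.
have -> : (n + zm * t + Z.of_nat 0 = n + Z.of_nat 0 + t * zm)%Z by lia.
rewrite Z.div_add; last by lia.
rewrite Z.mod_add; last by lia.
by rewrite Ht.
Qed.

(** * Decomposition of X into q phases *)

Hypotheses (q0 : 0 < q) (qm : q %| m).
Hypothesis recognition : exists N, forall a b : Z,
  agree N (fun i => u (i + a)%Z) (fun i => u (i + b)%Z) -> (Z.of_nat q | b - a)%Z.
Hypothesis density : forall (a : Z) n, exists b : Z,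
  agree n (fun i => u (i + Z.of_nat q * a)%Z) (fun i => u (i + zm * b)%Z).

(** Membership in the closure of the sigma^m-orbit of sigma^i u. *)
Definition phase (x : Z -> A) (i : nat) : Prop :=
  forall n, exists a, agree n x (fun z => u (z + (zm * a + Z.of_nat i))%Z).

Lemma phase_exists (x : Xpt u) : exists i : 'I_q, phase (proj1_sig x) i.
Proof.
have [N HN] := recognition; case: x => x Hx /=.
have [a0 Ha0] := Hx N.
have c1 := Z.div_mod a0 (Z.of_nat q) ltac:(lia).
have c2 := Z.mod_pos_bound a0 (Z.of_nat q) ltac:(lia).
have ltq : Z.to_nat (a0 mod Z.of_nat q)%Z < q by lia.
exists (Ordinal ltq) => n /=.
(* Recognition fixes [a] modulo [q] for all good approximations; density then replaces the
   progression of step [q] by one of step [m]. The extra radius [q] absorbs the translation by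
   [a0 mod q]. *)
have [a Ha] := Hx (maxn N n).
have [c Hc] : (Z.of_nat q | a - a0)%Z.
  apply: HN; apply: agree_trans (agree_sym Ha0) _.
  by apply: agree_le Ha; exact: leq_maxl.
have [b Hb] := density (c + a0 / Z.of_nat q) (n + q).
exists b => z Hz; rewrite (agree_le (leq_maxr N n) Ha) //=.
have := Hb (z + a0 mod Z.of_nat q)%Z ltac:(lia).
have -> : (z + a0 mod Z.of_nat q + Z.of_nat q * (c + a0 / Z.of_nat q) = z + a)%Z by lia.
by move=> ->; congr (u _); lia.
Qed.

(** Recognition makes the two translates of [u] congruent modulo [q]; as [q] divides [m], so are [i]
    and [j], which are both below [q]. *)
Lemma phase_local : exists N, forall x y (i j : 'I_q),
  phase x i -> phase y j -> agree N x y -> i = j.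
Proof.
have [N HN] := recognition; exists N => x y i j Hi Hj Hxy.
have [[a Ha] [b Hb]] := (Hi N, Hj N).
have [c Hc] := HN _ _ (agree_trans (agree_trans (agree_sym Ha) Hxy) Hb).
have /dvdnP [w Hw] := qm.
apply: ord_inj; have [lti ltj] := (ltn_ord i, ltn_ord j).
have E : (Z.of_nat j - Z.of_nat i = Z.of_nat q * (c + Z.of_nat w * (a - b)))%Z by nia.
set t := (c + _)%Z in E.
have t0 : t = 0%Z by nia.
by rewrite t0 in E; lia.
Qed.

Lemma phase_unique x (i j : 'I_q) : phase x i -> phase x j -> i = j.
Proof. by move=> Hi Hj; have [N HN] := phase_local; apply: (HN x x). Qed.

Definition ph (x : Xpt u) : 'I_q :=
  proj1_sig (constructive_indefinite_description _ (phase_exists x)).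

Lemma phP x : phase (proj1_sig x) (ph x).
Proof. by rewrite /ph; case: constructive_indefinite_description. Qed.

Lemma ph_local : exists N, forall x y : Xpt u,
  agree N (proj1_sig x) (proj1_sig y) -> ph x = ph y.
Proof.
have [N HN] := phase_local; exists N => x y; apply: HN; exact: phP.
Qed.

Lemma flat_phase i (y : Xpt v) : phase (flat i (proj1_sig y)) i.
Proof.
move=> n; have [a Ha] := proj2_sig y (n + i); exists a.
by move=> z Hz; rewrite (agree_flat Ha) // flat_block_shift.
Qed.

Lemma flat_closure i (y : Xpt v) : in_orbit_closure u (flat i (proj1_sig y)).
Proof. by move=> n; have [a Ha] := flat_phase i y n; eexists; exact: Ha. Qed.

(** Together with [ph] and [code] below, this identifies X with [q] copies of X(v), sigma^m acting
    on each copy as the shift. *)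
Definition emb (i : 'I_q) (y : Xpt v) : Xpt u := exist _ _ (flat_closure i y).

Lemma blk_closure (x : Xpt u) : in_orbit_closure v (blk (ph x) (proj1_sig x)).
Proof.
move=> n; have [a Ha] := phP x (m * n.+1 + ph x); exists a.
by move=> z Hz; rewrite (agree_blk Ha) // blk_shift.
Qed.

Definition code (x : Xpt u) : Xpt v := exist _ _ (blk_closure x).

Lemma ph_emb i y : ph (emb i y) = i.
Proof. exact: (phase_unique (phP (emb i y)) (flat_phase i y)). Qed.

Lemma emb_code x : emb (ph x) (code x) = x.
Proof. by apply: pt_inj => z; apply: blkK. Qed.

Lemma code_emb i y : code (emb i y) = y.
Proof. by apply: pt_inj => z; rewrite /= ph_emb flatK. Qed.

Lemma emb_cont i : contpt (emb i).
Proof. by move=> x n; exists (n + i) => y; apply: agree_flat. Qed.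

Lemma code_cont : contpt code.
Proof.
move=> x n; have [N HN] := ph_local.
exists (maxn N (m * n.+1 + q)) => y Hy /=.
rewrite -(HN x y (agree_le (leq_maxl _ _) Hy)).
apply: agree_blk; apply: agree_le Hy; have := ltn_ord (ph x); lia.
Qed.

Lemma emb_sigma i y : iter m (@sigmaX _ u) (emb i y) = emb i (sigmaX y).
Proof.
apply: pt_inj => z; rewrite iter_sigmaX /= /flat /shift.
have -> : (z + zm + Z.of_nat i = z + Z.of_nat i + 1 * zm)%Z by lia.
by rewrite Z.div_add ?Z.mod_add //; lia.
Qed.

(** * Homeomorphisms commuting with sigma^m as permutations of the phases *)

Lemma orbit_closed a : in_orbit_closure v (fun z => v (z + a)%Z).
Proof. by move=> n; exists a. Qed.

Definition orbit_pt a : Xpt v := exist _ _ (orbit_closed a).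

(** The function is constant on the orbit of [v], which is dense. *)
Lemma invariant_constant (I : Type) (h : Xpt v -> I) :
  (forall y, exists n, forall y', agree n (proj1_sig y) (proj1_sig y') -> h y = h y') ->
  (forall y, h (sigmaX y) = h y) -> forall y y', h y = h y'.
Proof.
move=> hc hs; suff H y : h y = h (orbit_pt 0) by move=> y y'; rewrite !H.
have Ho a : h (orbit_pt a) = h (orbit_pt 0).
  have step b : h (orbit_pt (Z.succ b)) = h (orbit_pt b).
    rewrite -[RHS]hs; congr h; apply: pt_inj => z /=; rewrite /shift; congr (v _); lia.
  elim/Z.peano_ind: a => [//|a <-|a <-]; first exact: step.
  by rewrite -[in RHS](Z.succ_pred a) step.
have [n Hn] := hc y; have [a Ha] := proj2_sig y n.
by rewrite (Hn (orbit_pt a)).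
Qed.

Local Notation sg := (iter m (@sigmaX _ u)).

Lemma ph_aut f i : contf f -> (forall x, f (sg x) = sg (f x)) ->
  forall y y', ph (f (emb i y)) = ph (f (emb i y')).
Proof.
move=> cf fs; apply: invariant_constant.
  move=> y; have [N HN] := ph_local.
  have [n Hn] := contpt_comp (f := f) cf (emb_cont i) y N.
  by exists n => y' Hy'; apply: HN; apply: Hn.
by move=> y; rewrite -emb_sigma fs -{1}[f _]emb_code emb_sigma ph_emb.
Qed.

(** Component [a.2 i] is sent to component [i] through [a.1 i]; this direction makes composition
    match [SD_mul]. *)
Definition permute (a : SD_grp v q) (x : Xpt u) : Xpt u :=
  let i := (a.2^-1)%g (ph x) in emb i (proj1_sig (a.1 i) (code x)).

Lemma permute_emb a i y :
  permute a (emb (a.2 i) y) = emb i (proj1_sig (a.1 i) y).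
Proof. by rewrite /permute ph_emb code_emb permK. Qed.

(** Stated for arbitrary [g] and [s] so as to cover both [permute] and its inverse; it holds because
    the phase is locally constant. *)
Lemma permute_cont (g : 'I_q -> Xpt v -> Xpt v) (s : 'I_q -> 'I_q) :
  (forall i, contf (g i)) -> contf (fun x => emb (s (ph x)) (g (ph x) (code x))).
Proof.
move=> cg x n; have [N HN] := ph_local.
have [k Hk] := contpt_comp (emb_cont (s (ph x)))
  (contpt_comp (f := g (ph x)) (cg (ph x)) code_cont) x n.
exists (maxn N k) => y Hy.
rewrite -(HN x y (agree_le (leq_maxl _ _) Hy)).
by apply: Hk; apply: agree_le Hy; exact: leq_maxr.
Qed.

Lemma sg_emb_code x : sg x = emb (ph x) (sigmaX (code x)).
Proof. by rewrite -emb_sigma emb_code. Qed.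

Lemma permute_sg a x : permute a (sg x) = sg (permute a x).
Proof.
have := permKV a.2 (ph x); set i := (a.2^-1)%g _ => Ei.
rewrite -[x]emb_code -Ei emb_sigma !permute_emb emb_sigma.
by have [_ ->] := proj2_sig (a.1 i).
Qed.

Lemma permute_autinf a : is_autinf (permute a).
Proof.
split; last by exists m; split=> // x; apply: permute_sg.
have Hg i := proj2 (proj1 (proj2_sig (a.1 i))).
pose g i := proj1_sig (constructive_indefinite_description _ (Hg i)).
have gP i : [/\ contf (g i), (forall x, g i (proj1_sig (a.1 i) x) = x)
               & (forall x, proj1_sig (a.1 i) (g i x) = x)].
  by rewrite /g; case: constructive_indefinite_description.
split.
  apply: (permute_cont (g := fun i => proj1_sig (a.1 ((a.2^-1)%g i)))) => i.
  exact: proj1 (proj1 (proj2_sig (a.1 _))).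
exists (fun x => emb (a.2 (ph x)) (g (ph x) (code x))); split.
- by apply: permute_cont => i; have [] := gP i.
- move=> x; rewrite /permute ph_emb code_emb permKV.
  by have [_ -> _] := gP ((a.2^-1)%g (ph x)); rewrite emb_code.
- move=> x; rewrite permute_emb.
  by have [_ _ ->] := gP (ph x); rewrite emb_code.
Qed.

Definition block_psi (a : SD_grp v q) : AutInf_grp u := exist _ _ (permute_autinf a).

Lemma block_psi_mono : gmono block_psi.
Proof.
split=> a b.
  apply: eq_sig_hprop => [f|]; first exact: proof_irrelevance.
  apply: functional_extensionality => x /=.
  have := permKV (a.2 * b.2)%g (ph x); set i := ((a.2 * b.2)^-1)%g _; rewrite permM => Ei.
  rewrite -[x]emb_code -Ei !permute_emb.
  by have := permute_emb (gmul a b) i (code x); rewrite /= permM.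
move=> /(f_equal (@proj1_sig _ _)) /= E.
(* The permutation is read off from the phases of the images of one point in each component. *)
have E2 : a.2 = b.2.
  apply/permP => i.
  have := permute_emb b ((b.2^-1)%g (a.2 i)) (orbit_pt 0).
  rewrite -E permKV permute_emb => /(f_equal ph); rewrite !ph_emb => {2}->.
  by rewrite permKV.
case: a b E E2 => a s [b t] /= E Est; subst t; congr (_, _).
apply: functional_extensionality => i.
apply: eq_sig_hprop => [f|]; first exact: proof_irrelevance.
apply: functional_extensionality => y.
have := permute_emb (b, s) i y; rewrite -E (permute_emb (a, s)).
by move/(f_equal code); rewrite !code_emb.
Qed.

Lemma block_psi_commute a x : proj1_sig (block_psi a) (sg x) = sg (proj1_sig (block_psi a) x).
Proof. exact: permute_sg. Qed.

Lemma block_psi_onto (h : AutInf_grp u) :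
  (forall x, proj1_sig h (sg x) = sg (proj1_sig h x)) -> exists a, block_psi a = h.
Proof.
case: h => f [[cf [f' [cf' fK f'K]]] Hn] Hf.
have fs x : f (sg x) = sg (f x) := Hf x.
have f's x : f' (sg x) = sg (f' x) by rewrite -{1}[x]f'K -fs fK.
pose al i := ph (f (emb i (orbit_pt 0))); pose al' i := ph (f' (emb i (orbit_pt 0))).
have fE i y : f (emb i y) = emb (al i) (code (f (emb i y))).
  by rewrite /al (ph_aut i cf fs _ y) emb_code.
have f'E i y : f' (emb i y) = emb (al' i) (code (f' (emb i y))).
  by rewrite /al' (ph_aut i cf' f's _ y) emb_code.
have alK i : al' (al i) = i.
  have := f'E (al i) (code (f (emb i (orbit_pt 0)))).
  by rewrite -fE fK => /(f_equal ph); rewrite !ph_emb.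
have al'K i : al (al' i) = i.
  have := fE (al' i) (code (f' (emb i (orbit_pt 0)))).
  by rewrite -f'E f'K => /(f_equal ph); rewrite !ph_emb.
(* The permutation is [al'], not [al]: [permute] maps component [s i] to component [i]. *)
pose s : {perm 'I_q} := perm (can_inj al'K).
pose g i y := code (f (emb (al' i) y)).
have gE i y : emb i (g i y) = f (emb (al' i) y) by rewrite fE al'K.
have aut_g i : is_aut (g i).
  split; last first.
    move=> y; have := gE i (sigmaX y); rewrite -emb_sigma fs -gE emb_sigma.
    by move/(f_equal code); rewrite !code_emb.
  split.
    exact: contpt_comp code_cont (contpt_comp (f := f) cf (emb_cont _)).
  exists (fun y => code (f' (emb i y))); split.
  - exact: contpt_comp code_cont (contpt_comp (f := f') cf' (emb_cont _)).
  - by move=> y; rewrite gE fK code_emb.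
  - by move=> y; rewrite /g -f'E f'K code_emb.
exists (fun i => exist _ _ (aut_g i), s).
apply: eq_sig_hprop => [x|]; first exact: proof_irrelevance.
apply: functional_extensionality => x /=.
have Ex : s (al (ph x)) = ph x by rewrite permE alK.
rewrite -[x]emb_code -Ex.
by rewrite permute_emb /= gE permE.
Qed.

End Blocks.

(** * The tower of groups and its limit *)

Lemma block_embedding (A : finType) (u : Z -> A) (p : nat -> nat) (k M : nat) :
  period_structure u p ->
  (forall l, k <= l -> gcdn M.+1 (p l) = p k) ->
  exists psi : SD_grp (blk M 0 u) (p k) -> AutInf_grp u,
    gmono psi /\ forall h, (exists a, psi a = h) <->
      (forall x, proj1_sig h (iter M.+1 (@sigmaX _ u) x)
                 = iter M.+1 (@sigmaX _ u) (proj1_sig h x)).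
Proof.
move=> Hp Hg; have [Hpos _ _ _] := Hp.
have qm : p k %| M.+1 by rewrite -(Hg k (leqnn k)) dvdn_gcdl.
have rec := phase_recognition Hp k; have den := progression_density Hp (ltn0Sn M) Hg.
exists (@block_psi _ _ _ _ (Hpos k) qm rec den); split; first exact: block_psi_mono.
move=> h; split; last exact: block_psi_onto.
by move=> [a <-] x; apply: block_psi_commute.
Qed.

Lemma tower_exists (A : finType) (u : Z -> A) (p : nat -> nat) :
  period_structure u p -> exists k M : nat -> nat,
  [/\ (forall j l, k j <= l -> gcdn (M j).+1 (p l) = p (k j)),
      (forall j, (M j).+1 %| (M j.+1).+1)
    & (forall n, 0 < n -> exists j, n %| (M j).+1)].
Proof.
move=> Hp; have [Hpos _ _ _] := Hp.
pose kap j := proj1_sig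
  (constructive_indefinite_description _ (stable_gcd Hp (fact_gt0 j))).
have kapP j : forall l, kap j <= l -> gcdn j`! (p l) = gcdn j`! (p (kap j)).
  by rewrite /kap; case: constructive_indefinite_description.
(* A running maximum, so that [p (K j)] divides [p (K j.+1)] and the [N j] form a divisibility
   chain. *)
pose K := fix K j := if j is i.+1 then maxn (K i) (kap i.+1) else kap 0.
have K_ge j : kap j <= K j by case: j => //= j; exact: leq_maxr.
pose N j := lcmn j`! (p (K j)).
have NE j : (N j).-1.+1 = N j by rewrite prednK // lcmn_gt0 fact_gt0 Hpos.
exists K, (fun j => (N j).-1); split.
- move=> j l Kl; rewrite NE; apply: (gcd_lcm_stable Hp) => // i Ki.
  by rewrite !kapP // (leq_trans (K_ge j)).
- move=> j; rewrite !NE dvdn_lcm; apply/andP; split.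
    by rewrite (dvdn_trans _ (dvdn_lcml _ _)) // factS dvdn_mull.
  rewrite (dvdn_trans _ (dvdn_lcmr _ _)) //.
  by apply: (structure_dvd Hp); exact: leq_maxl.
- move=> n n0; exists n; rewrite NE (dvdn_trans _ (dvdn_lcml _ _)) //.
  by apply: dvdn_fact; rewrite n0 leqnn.
Qed.

Theorem theorem1p2 (A : finType) (u : Z -> A) (p : nat -> nat) :
  toeplitz u -> period_structure u p ->
  exists (B : nat -> finType) (v : forall j : nat, Z -> B j) (k : nat -> nat)
         (phi : forall j : nat,
            SD_grp (v j) (p (k j)) -> SD_grp (v j.+1) (p (k j.+1))),
    [/\ (forall j, toeplitz (v j)),
        (forall j, gmono (phi j))
      & is_direct_limit (G := fun j => SD_grp (v j) (p (k j))) phi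
          (AutInf_grp u)].
Proof.
move=> Hu Hp; have [k [M [Hg Hdvd Hall]]] := tower_exists Hp.
pose v j := blk (M j) 0 u.
pose psi j := proj1_sig
  (constructive_indefinite_description _ (block_embedding Hp (Hg j))).
have psiP j : gmono (psi j) /\ forall h, (exists a, psi j a = h) <->
    (forall x, proj1_sig h (iter (M j).+1 (@sigmaX _ u) x)
               = iter (M j).+1 (@sigmaX _ u) (proj1_sig h x)).
  by rewrite /psi; case: constructive_indefinite_description.
(* Commuting with sigma^n implies commuting with its powers; this gives both the nesting of the
   images and their exhaustion of the stabilized group. *)
have dvd_onto j n (h : AutInf_grp u) : n %| (M j).+1 ->
    (forall x, proj1_sig h (iter n (@sigmaX _ u) x)
               = iter n (@sigmaX _ u) (proj1_sig h x)) -> exists a, psi j a = h.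
  move=> /dvdnP [c E] Hh; apply/(proj2 (psiP j)) => x.
  by rewrite E !iter_mul (commute_iter c (s := iter n (@sigmaX _ u)) Hh).
have [j g|h|phi [Hm Hl]] := @direct_limit_of_tower
    (fun j => SD_grp (v j) (p (k j))) (AutInf_grp u) psi (fun j => proj1 (psiP j)).
- by apply: (dvd_onto _ (M j).+1) => //; apply/(proj2 (psiP j)); exists g.
- have [_ [n [n0 Hn]]] := proj2_sig h; have [j Hj] := Hall n n0.
  by exists j; apply: dvd_onto Hj Hn.
exists (fun j => {ffun 'I_(M j).+1 -> A} : finType), v, k, phi; split=> // j.
exact: block_toeplitz Hu Hp.
Qed.
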